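(* Let $\Psi$ be a universal resource. Then $E_{\mathrm{wd}}(\Psi)=\chi_{\mathrm{wd}}(\Psi)=\infty$. Hence any resource on which $E_{\mathrm{wd}}$ or $\chi_{\mathrm{wd}}$ is bounded is not a universal resource.
   Context: For an $N$-qubit $|\psi\rangle$ and an $n$-qubit $|\phi\rangle$, $n\le N$, write $|\psi\rangle\geq_{\mathrm{LOCC}}|\phi\rangle$ if for some set $A$ of $n$ qubits the transformation $|\psi\rangle\to|\phi\rangle^A|0\rangle^{\bar A}$ is achievable exactly and with probability one by LOCC (each qubit a separate party). A resource is an infinite family $\Psi$ of multi-qubit pure states; it is universal if for every $n$ and every $n$-qubit state $|\phi\rangle$ some $|\psi\rangle\in\Psi$ has $|\psi\rangle\geq_{\mathrm{LOCC}}|\phi\rangle$. For a functional $E$, $E(\Psi):=\sup_{|\psi\rangle\in\Psi}E(|\psi\rangle)$. Subcubic tree: tree with all degrees in $\{1,3\}$, leaves = degree-1 vertices. For an $N$-qubit $|\psi\rangle$, take subcubic trees $T$ whose $N$ leaves are the qubits; removing edge $e$ induces a bipartition $(A^e_T,B^e_T)$ of the qubits. With $\rho_A=\mathrm{Tr}_B|\psi\rangle\langle\psi|$, define $E_{\mathrm{wd}}(|\psi\rangle)=\min_T\max_{e\in T}\big(-\mathrm{Tr}\,\rho_{A^e_T}\log_2\rho_{A^e_T}\big)$ (entropic entanglement width) and $\chi_{\mathrm{wd}}(|\psi\rangle)=\min_T\max_{e\in T}\log_2\mathrm{rank}\,\rho_{A^e_T}$ (Schmidt-rank width). *)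

(* Defs.v *)
From HB Require Import structures.
From mathcomp Require Import all_boot all_order all_algebra.
From mathcomp Require Import all_classical all_reals all_analysis.
From mathcomp.real_closed Require Import complex.

Set Implicit Arguments.
Unset Strict Implicit.
Unset Printing Implicit Defensive.

Import Order.TTheory GRing.Theory Num.Theory.
Local Open Scope ring_scope.
Local Open Scope classical_set_scope.

(** Computational basis configurations of N qubits (qubit i in state |x i>). *)
Notation cfg N := {ffun 'I_N -> bool}.

(** An (unnormalized) N-qubit pure state vector in (C^2)^{\otimes N},
    with complex scalars R[i]. *)
Notation qst R N := {ffun {ffun 'I_N -> bool} -> complex R}.

Section QuantumDefs.
Variable R : realType.
Local Notation C := (complex R).
Local Notation qstate N := (qst R N).

Definition sqnorm N (psi : qstate N) : R :=
  \sum_(x : cfg N) complex.Re (psi x * (psi x)^*).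

Definition normalized N (psi : qstate N) : Prop := sqnorm psi = 1.

(** ---------------- LOCC ---------------- *)

(** A local operator on one qubit: a 2x2 complex matrix, [M b c] = <b|M|c>. *)
Definition qop := bool -> bool -> C.

Definition setq N (x : cfg N) (k : 'I_N) (b : bool) : cfg N :=
  [ffun i => if i == k then b else x i].

(** Apply the local operator M on qubit k. *)
Definition apply_local N (k : 'I_N) (M : qop) (psi : qstate N) : qstate N :=
  [ffun x : cfg N => \sum_(c : bool) M (x k) c * psi (setq x k c)].

(** Kraus completeness  sum_m M_m^dagger M_m = I  for a finite-outcome local
    instrument on a single qubit. *)
Definition kraus_complete (m : nat) (ops : 'I_m -> qop) : Prop :=
  forall b b' : bool,
    \sum_(i < m) \sum_(c : bool) ((ops i c b)^* * ops i c b') = (b == b')%:R.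

(** Finite-round LOCC protocols on N parties (one qubit each): a party k
    performs a local instrument with Kraus operators ops, the outcome is
    broadcast, and the rest of the protocol depends on the outcome. *)
Inductive protocol (N : nat) : Type :=
| PStop : protocol N
| PMeasure : forall (k : 'I_N) (m : nat), ('I_m -> qop) -> ('I_m -> protocol N) -> protocol N.

(** [achieves P psi tgt]: every branch of P started on psi ends (exactly) in a
    vector proportional to tgt.  Together with normalisation of psi and tgt this
    is exact, deterministic (probability one) conversion. *)
Fixpoint achieves N (P : protocol N) (psi tgt : qstate N) : Prop :=
  match P with
  | PStop => exists c : C, psi = [ffun x => c * tgt x]
  | PMeasure k m ops next =>
      kraus_complete ops /\
      forall i : 'I_m, achieves (next i) (apply_local k (ops i) psi) tgt
  end.

(** |phi>^A |0>^{\bar A}: the n-qubit phi placed on the qubits f 'I_n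
    (f injective), all remaining qubits in |0>. *)
Definition embed_state n N (f : 'I_n -> 'I_N) (phi : qstate n) : qstate N :=
  [ffun x : cfg N =>
     if [forall i : 'I_N, (i \notin codom f) ==> ~~ x i]
     then phi [ffun j => x (f j)] else 0].

(** psi >=_LOCC phi *)
Definition locc_ge N n (psi : qstate N) (phi : qstate n) : Prop :=
  (n <= N)%N /\
  exists (f : 'I_n -> 'I_N), injective f /\
    exists P : protocol N, achieves P psi (embed_state f phi).

(** A resource: an infinite family of (normalized) multi-qubit pure states. *)
Definition mqstate := {N : nat & qstate N}.

Definition resource (Psi : set mqstate) : Prop :=
  ~ finite_set Psi /\ forall p, Psi p -> normalized (projT2 p).

Definition universal (Psi : set mqstate) : Prop :=
  forall (n : nat) (phi : qstate n), normalized phi ->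
    exists p, Psi p /\ locc_ge (projT2 p) phi.

(** ---------------- reduced density matrices ---------------- *)

(** Configurations supported on A (qubits outside A are 0); these index the
    computational basis of the subsystem A. *)
Definition cfgOn N (A : {set 'I_N}) :=
  {x : cfg N | [forall i : 'I_N, (i \notin A) ==> ~~ x i]}.

Definition glue N (A : {set 'I_N}) (x z : cfg N) : cfg N :=
  [ffun i => if i \in A then x i else z i].

(** rho_A = Tr_{\bar A} |psi><psi|, as a #|cfgOn A| x #|cfgOn A| matrix. *)
Definition rho N (psi : qstate N) (A : {set 'I_N}) : 'M[C]_#|{: cfgOn A}| :=
  \matrix_(i, j)
    \sum_(z : cfgOn (~: A))
      psi (glue A (val (enum_val i)) (val z)) *
      (psi (glue A (val (enum_val j)) (val z)))^*.

Definition log2 (x : R) : R := ln x / ln 2.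

(** -t log2 t, with 0 log 0 = 0. *)
Definition negxlog2x (t : R) : R := if t == 0 then 0 else - (t * log2 t).

(** von Neumann entropy -Tr rho log2 rho = - sum_lambda lambda log2 lambda,
    lambda ranging over the eigenvalues of rho with multiplicity (the roots of
    the characteristic polynomial). *)
Definition vn_entropy n (M : 'M[C]_n) : R :=
  xget 0 [set h : R | exists s : seq C,
     char_poly M = \prod_(z <- s) ('X - z%:P) /\
     h = \sum_(z <- s) negxlog2x (complex.Re z)].

(** ---------------- subcubic trees ---------------- *)

Definition deg (V : finType) (adj : rel V) (v : V) : nat := #|[set w | adj v w]|.

(** A subcubic tree whose leaves are (bijectively) the N qubits. *)
Record sctree (N : nat) := SCTree {
  nv : nat;
  tadj : rel 'I_nv;
  leaf : 'I_N -> 'I_nv;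
  tadj_sym : symmetric tadj;
  tadj_irr : irreflexive tadj;
  tconnected : forall u v, connect tadj u v;
  tacyclic : forall (x : 'I_nv) (p : seq 'I_nv),
      ~~ [&& uniq (x :: p), (2 <= size p)%N, path tadj x p & tadj (last x p) x];
  tdeg : forall v, (deg tadj v == 1)%N || (deg tadj v == 3)%N;
  leaf_deg : forall i, (deg tadj (leaf i) == 1)%N;
  leaf_inj : injective leaf;
  leaf_onto : forall v, (deg tadj v == 1)%N -> exists i, leaf i = v
}.

(** Removing the edge {u,v}: the side A of the bipartition is the set of qubits
    whose leaf is still connected to u. *)
Definition side N (T : sctree N) (u v : 'I_(nv T)) : {set 'I_N} :=
  [set i | connect [rel x y | @tadj N T x y &&
              ~~ (((x == u) && (y == v)) || ((x == v) && (y == u)))]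
                   u (leaf T i)].

(** max over the edges of T of a functional g of the induced bipartition. *)
Definition tree_max N (T : sctree N) (g : {set 'I_N} -> R) : R :=
  \big[Order.max/0]_(e : 'I_(nv T) * 'I_(nv T) | @tadj N T e.1 e.2) g (@side N T e.1 e.2).

(** min over trees of max over edges (for N <= 1 there is no bipartition and
    the width is 0 by convention). *)
Definition width N (g : {set 'I_N} -> R) : \bar R :=
  if (N <= 1)%N then 0%E
  else ereal_inf [set r : \bar R | exists T : sctree N, r = (tree_max T g)%:E].

Definition E_wd N (psi : qstate N) : \bar R :=
  width (fun A => vn_entropy (rho psi A)).

Definition chi_wd N (psi : qstate N) : \bar R :=
  width (fun A => log2 (\rank (rho psi A))%:R).

(** E(Psi) := sup_{psi in Psi} E(psi) *)
Definition sup_res (E : forall N, qstate N -> \bar R) (Psi : set mqstate) : \bar R :=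
  ereal_sup [set E (projT1 p) (projT2 p) | p in Psi].

End QuantumDefs.

(* Main.v *)
Require Import Defs.
From HB Require Import structures.
From mathcomp Require Import all_boot all_order all_algebra.
From mathcomp Require Import spectral sesquilinear mxabelem.
From mathcomp Require Import all_classical all_reals all_analysis.
From mathcomp.real_closed Require Import complex.
From mathcomp Require Import ring lra zify.
(* The classical libraries shadow names of these modules. *)
Import boot.fintype boot.fingraph boot.finset Defs.

(** The purity [Tr rho_A^2] controls both widths: the collision entropy
    [- log2 (Tr rho_A^2)] bounds from below the von Neumann entropy and
    [log2 (rank rho_A)].  A local measurement on one side of a cut decomposes the
    reduced state of the other side into the unnormalized reduced states of the
    outcomes, so the triangle inequality for the Frobenius norm shows that LOCC
    cannot increase the collision entropy across any cut.

    As targets take the cluster states of square grids.  Every subcubic tree has an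
    edge leaving at least a third of the target qubits on each side.  A balanced cut
    of the grid meets a third of the rows, or else it meets every column; taking one
    cut edge in each of these lines, restricted to lines of equal parity, gives a
    large induced matching between the two sides.  The collision entropy of a graph
    state is the rank over F_2 of the adjacency matrix between the two sides, which
    is at least the size of such a matching. *)

Set Implicit Arguments.
Unset Strict Implicit.
Unset Printing Implicit Defensive.
Import Order.TTheory GRing.Theory Num.Theory.
Local Open Scope ring_scope.
Local Open Scope sesquilinear_scope.

(** * Balanced edges of subcubic trees *)

(* [deg] counts a classical set, whose membership is [asbool] of the relation. *)
Lemma degE (V : finType) (adj : rel V) v : deg adj v = #|[set w | adj v w]|.
Proof. by apply: eq_card => w; rewrite [RHS]inE; apply: boolp.asboolb. Qed.

Section SubcubicTree.
Variables (N : nat) (T : sctree N).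
Local Notation adj := (@tadj N T).
Implicit Types u v a : 'I_(nv T).

Definition cut_rel u v : rel 'I_(nv T) := fun x y =>
  adj x y && ~~ (((x == u) && (y == v)) || ((x == v) && (y == u))).

Definition branch u v : {set 'I_(nv T)} := [set x | connect (cut_rel u v) u x].

Lemma side_branch u v : side u v = leaf T @^-1: branch u v.
Proof. by apply/setP => i; rewrite !inE. Qed.

Lemma branch_root u v : u \in branch u v.
Proof. by rewrite inE connect0. Qed.

Lemma cut_relC u v : cut_rel u v =2 cut_rel v u.
Proof. by move=> x y; rewrite /cut_rel orbC. Qed.

Lemma cut_rel_sub u v : subrel (cut_rel u v) adj.
Proof. by move=> x y /andP[]. Qed.

Lemma path_cut_rel u v x p :
  path adj x p -> v \notin x :: p -> path (cut_rel u v) x p.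
Proof.
move=> px vNp; apply: (sub_in_path (P := [pred z | z != v]) (e := adj)) px.
  by move=> y z /= /negPf yv /negPf zv yz; rewrite /cut_rel yz yv zv andbF.
by apply/allP => z zp /=; apply: contraNneq vNp => <-.
Qed.

Lemma branch_far_end u v : adj u v -> v \notin branch u v.
Proof.
move=> uv; rewrite inE; apply/connectP => -[_ /shortenP[p cut_p uniq_p _] vE].
have adj_p : path adj u p by apply: sub_path cut_p; apply: cut_rel_sub.
have := tacyclic u p; rewrite uniq_p adj_p -vE tadj_sym uv /= andbT.
case: p cut_p vE {uniq_p adj_p} => [|w [|w' p]] //=.
  by move=> _ vE; move: uv; rewrite vE tadj_irr.
by move=> + vE; rewrite /cut_rel -vE !eqxx /= andbF.
Qed.

Lemma branch_child_sub u v a :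
  adj v a -> a != u -> branch a v \subset branch v u.
Proof.
move=> va au; apply/subsetP => y; rewrite !inE => /connectP[p cut_p yE].
have vNp : v \notin a :: p.
  have av : adj a v by rewrite tadj_sym.
  by apply: contra (branch_far_end av) => /(path_connect cut_p); rewrite inE.
have va_cut : cut_rel v u v a.
  rewrite /cut_rel va (negPf au) andbF /=; apply/negP => /andP[_ /eqP av].
  by rewrite av inE eqxx in vNp.
apply: connect_trans (connect1 va_cut) _; apply/connectP; exists p => //.
rewrite (eq_path (@cut_relC v u)); apply: path_cut_rel vNp.
by apply: sub_path cut_p; apply: cut_rel_sub.
Qed.

Lemma branchE u v :
  branch v u = v |: \bigcup_(a | adj v a && (a != u)) branch a v.
Proof.
apply/setP => y; rewrite in_setU1; apply/idP/predU1P => [|[->|]]; last 2 first.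
- exact: branch_root.
- by move=> /bigcupP[a /andP[va au]]; apply/subsetP/branch_child_sub.
rewrite inE => /connectP[_ /shortenP[p cut_p uniq_p _] ->].
case: p cut_p uniq_p => [|a p] /=; first by left.
move=> /andP[/andP[va vNa] cut_p] /andP[vNp _]; right; apply/bigcupP; exists a.
  by rewrite va; apply: contraNneq vNa => ->; rewrite !eqxx.
rewrite inE; apply/connectP; exists p => //; apply: path_cut_rel => //.
by apply: sub_path cut_p; apply: cut_rel_sub.
Qed.

Lemma branch_cover u v y : adj u v -> y \in branch u v :|: branch v u.
Proof.
move=> uv.
have cover_closed : closed adj (branch u v :|: branch v u).
  apply: intro_closed => [|x z xz]; first exact: sym_connect_sym (@tadj_sym _ T).
  have [xz_uv _|xz_cut] :=
    boolP (((x == u) && (z == v)) || ((x == v) && (z == u))).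
    by rewrite inE; case/orP: xz_uv => /andP[_ /eqP->];
      rewrite branch_root ?orbT.
  have xz_step : cut_rel u v x z by rewrite /cut_rel xz.
  rewrite !inE => /orP[ux|vx].
    by rewrite (connect_trans ux (connect1 xz_step)).
  by rewrite (connect_trans vx) ?orbT // connect1 // cut_relC.
rewrite -(closed_connect cover_closed (tconnected u y)).
by rewrite inE branch_root.
Qed.

Lemma side_leaf u v i : leaf T i = v -> adj v u -> side v u = [set i].
Proof.
move=> <- iu; have := leaf_deg T i; rewrite degE => /cards1P[w wE].
have only_u a : adj (leaf T i) a -> a = u.
  move=> ia; have : a \in [set w | adj (leaf T i) w] by rewrite inE.
  have : u \in [set w | adj (leaf T i) w] by rewrite inE.
  by rewrite wE !inE => /eqP-> /eqP.
apply/setP => j; rewrite side_branch branchE inE big_pred0 => [|a].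
  by rewrite setU0 !inE (inj_eq (@leaf_inj _ T)).
by apply/negP => /andP[/only_u-> /eqP].
Qed.

Lemma side_inner u v : deg adj v == 3 -> adj v u -> exists a b,
  [/\ adj v a && (a != u), adj v b && (b != u)
    & side v u = side a v :|: side b v].
Proof.
move=> deg_v vu.
have /cards2P[a [b [ab childE]]] : #|[set w | adj v w] :\ u| == 2.
  by have := cardsD1 u [set w | adj v w];
    rewrite -degE (eqP deg_v) inE vu => -[/esym/eqP].
have child w : adj v w && (w != u) = (w == a) || (w == b).
  by have := in_set2 w a b; rewrite -childE !inE andbC.
exists a, b; split; rewrite ?child ?eqxx ?orbT //.
apply/setP => i; rewrite !side_branch branchE !inE.
have /negPf-> : leaf T i != v.
  by apply: contraTneq (leaf_deg T i) => ->; rewrite (eqP deg_v).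
rewrite (eq_bigl [in [set a; b]]) => [|w]; last by rewrite child !inE.
by rewrite bigcup_setU !big_set1 !inE.
Qed.

Section Balanced.
Variables (n : nat) (f : 'I_n -> 'I_N).
Hypothesis f_inj : injective f.

Let load u v : nat := #|f @^-1: side u v|.
Let heavy : pred ('I_(nv T) * 'I_(nv T)) :=
  fun e => adj e.1 e.2 && (n <= 3 * load e.1 e.2)%N.

Lemma load_cover u v : adj u v -> (n <= load u v + load v u)%N.
Proof.
move=> uv; rewrite -[leqLHS]card_ord -cardsT /load -cardsUI.
apply: leq_trans (leq_addr _ _).
apply/subset_leq_card/subsetP => i _.
by have := branch_cover (leaf T (f i)) uv; rewrite !side_branch !inE.
Qed.

Lemma exists_heavy_edge : (0 < n)%N -> exists e, heavy e.
Proof.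
move=> n0; pose i := Ordinal n0.
have := leaf_deg T (f i); rewrite degE => /cards1P[w wE].
have iw : adj (leaf T (f i)) w.
  by have := set11 w; rewrite -wE inE.
have [|light] := leqP n (3 * load (leaf T (f i)) w).
  by exists (leaf T (f i), w); rewrite /heavy iw.
exists (w, leaf T (f i)); rewrite /heavy /= tadj_sym iw /=.
by have := load_cover iw; lia.
Qed.

(* Among the edges with a third of the load on one side, one whose branch on that
   side is minimal carries at most two thirds of it: its child branches are light. *)
Lemma balanced_edge : (3 < n)%N -> exists u v,
  [/\ adj u v, (n <= 3 * #|f @^-1: side u v|)%N
    & (n <= 3 * #|~: (f @^-1: side u v)|)%N].
Proof.
move=> n3; have [|e0 heavy_e0] := exists_heavy_edge; first exact: leq_trans n3.
have [[v u] /andP[/= vu heavy_vu] min_vu] :=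
  @arg_minnP _ e0 heavy (fun e => #|branch e.1 e.2|) heavy_e0.
exists v, u; split => //.
have light_child a : adj v a && (a != u) -> (3 * load a v < n)%N.
  case/andP=> va au; rewrite ltnNge; apply/negP => heavy_a.
  have := min_vu (a, v); rewrite /heavy /= tadj_sym va heavy_a => /(_ isT).
  apply/negP; rewrite -ltnNge; apply: proper_card; rewrite properE.
  rewrite branch_child_sub //; apply/subsetPn; exists v; first exact: branch_root.
  by rewrite branch_far_end // tadj_sym.
suff : (3 * load v u <= 2 * n)%N.
  have := cardsC (f @^-1: side v u); rewrite card_ord /load.
  by move: #|~: _| #|_ @^-1: _| => x y; lia.
case/orP: (tdeg v) => [/leaf_onto[i iv]|/side_inner/(_ vu)[a [b]]].
  suff : (load v u <= 1)%N by lia.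
  rewrite /load (side_leaf iv vu) -(card_imset _ f_inj) -(cards1 i).
  by apply/subset_leq_card/subsetP => _ /imsetP[x + ->]; rewrite !inE.
case=> /light_child light_a /light_child light_b sideE.
suff : (load v u <= load a v + load b v)%N by lia.
by rewrite /load sideE preimsetU cardsU leq_subr.
Qed.

End Balanced.
End SubcubicTree.

(** * Matchings across cuts of a grid *)

Definition cut_matching (V : finType) (E : rel V) (A : {set V})
    (I : {set V * V}) : Prop :=
  (forall p, p \in I -> (p.1 \in A) && (p.2 \notin A)) /\
  (forall p q, p \in I -> q \in I -> E p.1 q.2 = (p == q)).

Lemma cut_matching_imset (V W : finType) (E : rel V) (F : rel W) (h : V -> W)
    (A : {set W}) (I : {set V * V}) :
  injective h -> (forall x y, F (h x) (h y) = E x y) ->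
  cut_matching E (h @^-1: A) I ->
  exists2 J, cut_matching F A J & #|J| = #|I|.
Proof.
move=> h_inj hE [I_cut I_ind]; pose h2 (p : V * V) := (h p.1, h p.2).
have h2_inj : injective h2 by move=> [a b] [c d] [/h_inj-> /h_inj->].
exists (h2 @: I); last by rewrite card_imset.
split=> [_ /imsetP[p pI ->]|_ _ /imsetP[p pI ->] /imsetP[q qI ->]].
  by have := I_cut p pI; rewrite !inE.
by rewrite hE I_ind // (inj_eq h2_inj).
Qed.

Lemma connect_boundary (V : finType) (e : rel V) (g : pred V) x y :
  connect e x y -> g x -> ~~ g y -> exists u v, [/\ e u v, g u & ~~ g v].
Proof.
case/connectP=> p; elim: p x => [|z p IH] x /=; first by move=> _ -> ->.
case/andP=> xz zp yE gx ngy; have [gz|ngz] := boolP (g z); last by exists x, z.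
exact: IH zp yE gz ngy.
Qed.

Section BoxProduct.
Variables (V W : finType) (E : rel V) (F : rel W).

Definition box_rel : rel (V * W) := fun p q =>
  ((p.1 == q.1) && F p.2 q.2) || ((p.2 == q.2) && E p.1 q.1).

Definition mixed_rows (A : {set V * W}) : {set V} :=
  [set i | [exists j, (i, j) \in A] && [exists j, (i, j) \notin A]].

Definition stable (X : {set V}) : Prop :=
  forall i j, i \in X -> j \in X -> ~~ E i j.

Lemma mixed_rowsC A : mixed_rows (~: A) = mixed_rows A.
Proof.
apply/setP => i; rewrite !inE andbC; congr (_ && _);
  by apply: eq_existsb => j; rewrite !inE ?negbK.
Qed.

Lemma mixed_rows_matching A X :
  (forall j l, connect F j l) -> stable X -> X \subset mixed_rows A ->
  exists2 I, cut_matching box_rel A I & #|I| = #|X|.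
Proof.
move=> F_conn X_stable /subsetP X_mixed.
have [->|[i0 /X_mixed]] := set_0Vmem X.
  by exists set0; rewrite ?cards0 //; split=> [p|p q]; rewrite inE.
rewrite inE => /andP[/existsP[j0 _] _].
have cut_edge i : exists e : W * W,
    (i \in X) ==> [&& F e.1 e.2, (i, e.1) \in A & (i, e.2) \notin A].
  have [/X_mixed|] := boolP (i \in X); last by exists (j0, j0).
  rewrite inE => /andP[/existsP[a aA] /existsP[b bA]].
  have [j [l [jl jA lA]]] :=
    connect_boundary (g := fun j => (i, j) \in A) (F_conn a b) aA bA.
  by exists (j, l); rewrite /= jl jA.
pose edge i := xchoose (cut_edge i).
have edgeP i : i \in X ->
    [/\ F (edge i).1 (edge i).2, (i, (edge i).1) \in A & (i, (edge i).2) \notin A].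
  by move=> iX; apply/and3P; apply: implyP iX; apply: (xchooseP (cut_edge i)).
pose lift_edge i := ((i, (edge i).1), (i, (edge i).2)).
have lift_inj : injective lift_edge by move=> i j [].
exists (lift_edge @: X); last by rewrite card_imset.
split=> [_ /imsetP[i iX ->]|_ _ /imsetP[i iX ->] /imsetP[j jX ->]].
  by have [_ -> ->] := edgeP i iX.
rewrite (inj_eq lift_inj) /box_rel /= (negPf (X_stable _ _ iX jX)) andbF orbF.
by case: eqVneq => [<-|//]; have [-> _ _] := edgeP i iX.
Qed.

Lemma full_row_exists A :
  (3 * #|mixed_rows A| < #|V|)%N -> (0 < #|W|)%N -> (#|V| * #|W| <= 3 * #|A|)%N ->
  exists i, forall j, (i, j) \in A.
Proof.
move=> few_mixed W0 A_large.
have [/existsP[i /andP[i_pure /existsP[j ijA]]]|no_pure] :=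
    boolP [exists i, (i \notin mixed_rows A) && [exists j, (i, j) \in A]].
  exists i => l; apply: contraNT i_pure => ilA; rewrite inE.
  by apply/andP; split; apply/existsP; [exists j | exists l].
have : (#|A| <= #|mixed_rows A| * #|W|)%N.
  rewrite -[#|W|]cardsT -cardsX; apply/subset_leq_card/subsetP => -[i j] ijA.
  rewrite in_setX in_setT andbT; apply: contraNT no_pure => i_pure.
  by apply/existsP; exists i; rewrite i_pure; apply/existsP; exists j.
have : (3 * (#|mixed_rows A| * #|W|) < #|V| * #|W|)%N.
  by rewrite mulnA ltn_pmul2r.
by move: A_large; move: (#|V| * _)%N (#|mixed_rows A| * _)%N #|A| => a b c; lia.
Qed.

End BoxProduct.

Lemma balanced_mixed_lines (V W : finType) (A : {set V * W}) :
  (#|V| * #|W| <= 3 * #|A|)%N -> (#|V| * #|W| <= 3 * #|~: A|)%N ->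
  (#|V| <= 3 * #|mixed_rows A|)%N \/ mixed_rows (@swap_pair W V @^-1: A) = setT.
Proof.
move=> A_large AC_large.
have [|few_mixed] := leqP #|V| (3 * #|mixed_rows A|); [by left | right].
apply/setP => j; have W0 : (0 < #|W|)%N by apply/card_gt0P; exists j.
have [i iA] := full_row_exists few_mixed W0 A_large.
have [i' iA'] : exists i, forall j, (i, j) \in ~: A.
  by apply: full_row_exists W0 AC_large; rewrite mixed_rowsC.
rewrite !inE; apply/andP; split; apply/existsP; [exists i | exists i'].
  by rewrite inE iA.
by have := iA' j; rewrite !inE.
Qed.

Definition path_rel m : rel 'I_m := fun i j => (j == i.+1 :> nat) || (i == j.+1 :> nat).

Lemma path_rel_connect m (i j : 'I_m) : connect (@path_rel m) i j.
Proof.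
have conn_sym : connect_sym (@path_rel m).
  by apply: sym_connect_sym => x y; rewrite /path_rel orbC.
wlog ij : i j / (i <= j)%N.
  by move=> conn; case/orP: (leq_total i j) => /conn //; rewrite conn_sym.
have conn_ord k : forall km : (k < m)%N, (i <= k)%N ->
    connect (@path_rel m) i (Ordinal km).
  elim: k => [|k IH] km; rewrite leq_eqVlt => /predU1P[ik|ik].
  - by rewrite (_ : i = Ordinal km) ?connect0 //; apply: val_inj.
  - by rewrite ltn0 in ik.
  - by rewrite (_ : i = Ordinal km) ?connect0 //; apply: val_inj.
  - apply: connect_trans (IH (ltnW km) ik) (connect1 _).
    by rewrite /path_rel /= eqxx.
by have := conn_ord j (ltn_ord j) ij; rewrite (_ : Ordinal _ = j) //; apply: val_inj.
Qed.

Lemma path_rel_stable_subset m (X : {set 'I_m}) : exists Y : {set 'I_m},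
  [/\ Y \subset X, (#|X| <= 2 * #|Y|)%N & stable (@path_rel m) Y].
Proof.
pose odds := [set i : 'I_m | odd i].
have [few_odd|many_odd] := leqP #|X :&: odds| #|X :\: odds|.
  exists (X :\: odds); split; first exact: subsetDl.
    by rewrite -(cardsID odds X) mul2n -addnn leq_add2r.
  by move=> i j; rewrite !inE /path_rel; lia.
exists (X :&: odds); split; first exact: subsetIl.
  by rewrite -(cardsID odds X) mul2n -addnn leq_add2l ltnW.
by move=> i j; rewrite !inE /path_rel; lia.
Qed.

Definition grid_rel m : rel ('I_m * 'I_m) := box_rel (@path_rel m) (@path_rel m).

Lemma mixed_rows_grid_matching m (A : {set 'I_m * 'I_m}) :
  exists2 I, cut_matching (@grid_rel m) A I & (#|mixed_rows A| <= 2 * #|I|)%N.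
Proof.
have [Y [Y_mixed Y_large Y_stable]] := path_rel_stable_subset (mixed_rows A).
have [I I_match I_card] :=
  mixed_rows_matching (@path_rel_connect m) Y_stable Y_mixed.
by exists I; rewrite // I_card.
Qed.

Lemma grid_balanced_matching m (A : {set 'I_m * 'I_m}) :
  (m * m <= 3 * #|A|)%N -> (m * m <= 3 * #|~: A|)%N ->
  exists2 I, cut_matching (@grid_rel m) A I & (m <= 6 * #|I|)%N.
Proof.
move=> A_large AC_large; have := @balanced_mixed_lines _ _ A; rewrite !card_ord.
case/(_ A_large AC_large) => [rows_mixed|cols_mixed].
  have [I I_match I_large] := mixed_rows_grid_matching A.
  by exists I => //; lia.
have [I I_match] := mixed_rows_grid_matching (@swap_pair _ _ @^-1: A).
rewrite cols_mixed cardsT card_ord => I_large.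
have [J J_match J_card] : exists2 J, cut_matching (@grid_rel m) A J & #|J| = #|I|.
  apply: cut_matching_imset I_match => [[? ?] [? ?] [-> ->] //|x y].
  by rewrite /grid_rel /box_rel orbC.
by exists J; rewrite // J_card; lia.
Qed.

(** * Spectra, entropy and rank *)

Lemma mxrank_mxsub (F : fieldType) m n p q (f : 'I_p -> 'I_m) (g : 'I_q -> 'I_n)
    (A : 'M[F]_(m, n)) : (\rank (mxsub f g A) <= \rank A)%N.
Proof.
rewrite -[A in mxsub _ _ A]mulmx1 mxsub_mul rowsubE.
exact: leq_trans (mxrankM_maxl _ _) (mxrankM_maxr _ _).
Qed.

Lemma mxrank_diag_ge (F : fieldType) n (d : 'rV[F]_n) :
  (#|[set i | (d 0 i != 0)%R]| <= \rank (diag_mx d))%N.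
Proof.
set S := [set i | _]; pose f (i : 'I_#|S|) := enum_val i.
apply: leq_trans (mxrank_mxsub f f (diag_mx d)).
have -> : mxsub f f (diag_mx d) = diag_mx (\row_i d 0 (f i)).
  by apply/matrixP => i j; rewrite !mxE (inj_eq enum_val_inj).
rewrite mxrank_unit // unitmxE unitfE det_diag prodf_seq_neq0.
by apply/allP => i _; have := enum_valP i; rewrite inE mxE.
Qed.

Lemma char_poly_conj (F : fieldType) n (P D : 'M[F]_n) :
  P \in unitmx -> char_poly (invmx P *m D *m P) = char_poly D.
Proof.
move=> P_unit; rewrite /char_poly.
suff -> : char_poly_mx (invmx P *m D *m P) =
    map_mx polyC (invmx P) *m char_poly_mx D *m map_mx polyC P.
  rewrite !det_mulmx mulrC mulrA -det_mulmx -map_mxM mulmxV // map_mx1 det1.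
  by rewrite mul1r.
rewrite /char_poly_mx mulmxBr mulmxBl -!map_mxM mul_mx_scalar -scalemxAl.
by rewrite -map_mxM mulVmx // map_mx1 scalemx1.
Qed.

Section NormalMatrix.
Variables (C : numClosedFieldType) (n : nat) (M : 'M[C]_n).
Hypothesis M_normal : M \is normalmx.
Local Notation P := (spectralmx M).
Local Notation d := (spectral_diag M).

Let P_unit : P \in unitmx := spectral_unit M.
Let ME : M = invmx P *m diag_mx d *m P := orthomx_spectralP M_normal.

Lemma char_poly_normal : char_poly M = \prod_i ('X - (d 0 i)%:P).
Proof.
rewrite {1}ME char_poly_conj // char_poly_trig ?diag_mx_is_trig //.
by apply: eq_bigr => i _; rewrite mxE eqxx.
Qed.

Lemma mxtrace_normal : \tr M = \sum_i d 0 i.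
Proof. by rewrite {1}ME mxtrace_mulC mulmxA mulmxV // mul1mx mxtrace_diag. Qed.

Lemma mxtrace_normal_sqr : \tr (M *m M) = \sum_i d 0 i ^+ 2.
Proof.
have -> : M *m M = invmx P *m (diag_mx d *m diag_mx d) *m P.
  by rewrite {1 2}ME !mulmxA mulmxK.
rewrite -mulmxA mxtrace_mulC mulmxK // mulmx_diag mxtrace_diag.
by apply: eq_bigr => i _; rewrite mxE expr2.
Qed.

Lemma mxrank_normal_ge : (#|[set i | (d 0 i != 0)%R]| <= \rank M)%N.
Proof.
apply: leq_trans (mxrank_diag_ge d) _.
have -> : diag_mx d = P *m M *m invmx P.
  by rewrite [X in _ *m X *m _]ME !mulmxA mulmxV // mul1mx mulmxK.
exact: leq_trans (mxrankM_maxl _ _) (mxrankM_maxr _ _).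
Qed.

End NormalMatrix.

Lemma gram_normalmx (C : numClosedFieldType) n p (X : 'M[C]_(n, p)) :
  X *m X^t* \is normalmx.
Proof. by apply/normalmxP; rewrite trmx_mul map_mxM trmxCK. Qed.

Lemma spectral_diag_gram_ge0 (C : numClosedFieldType) n p (X : 'M[C]_(n, p)) i :
  0 <= spectral_diag (X *m X^t*) 0 i.
Proof.
set M := X *m X^t*; set P := spectralmx M; set d := spectral_diag M.
have ME : M = invmx P *m diag_mx d *m P := orthomx_spectralP (gram_normalmx X).
have P_unit : P \in unitmx := spectral_unit M.
have dE : diag_mx d = (P *m X) *m (P *m X)^t*.
  rewrite trmx_mul map_mxM mulmxA -[P *m X *m _]mulmxA -/M.
  rewrite -invmx_unitary ?spectral_unitarymx // [X in P *m X *m _]ME.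
  by rewrite !mulmxA mulmxV // mul1mx mulmxK.
have -> : d 0 i = diag_mx d i i by rewrite mxE eqxx.
rewrite dE mxE; apply: sumr_ge0 => j _.
by rewrite !mxE mul_conjC_ge0.
Qed.

Lemma sqr_sum_le_support (F : realFieldType) (T : finType) (p : T -> F) :
  (\sum_t p t) ^+ 2 <= #|[set t | (p t != 0)%R]|%:R * \sum_t p t ^+ 2.
Proof.
set S := [set t | _]; set s := \sum_t p t; set q := \sum_t p t ^+ 2.
have sum_support (F0 : T -> F) : (forall t, p t = 0 -> F0 t = 0) ->
    \sum_t F0 t = \sum_(t in S) F0 t.
  move=> F00; rewrite [RHS]big_mkcond; apply: eq_bigr => t _; rewrite inE.
  by case: eqVneq => // /F00.
have [S0|S_gt0] := posnP #|S|.
  by rewrite /s sum_support // (cards0_eq S0) big_set0 cards0 expr0n mul0r.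
have k0 : 0 < #|S|%:R :> F by rewrite ltr0n.
have : 0 <= \sum_(t in S) (#|S|%:R * p t - s) ^+ 2.
  by apply: sumr_ge0 => t _; apply: sqr_ge0.
have -> : \sum_(t in S) (#|S|%:R * p t - s) ^+ 2 = #|S|%:R * (#|S|%:R * q - s ^+ 2).
  transitivity (\sum_(t in S)
      (#|S|%:R ^+ 2 * p t ^+ 2 - 2 * #|S|%:R * s * p t + s ^+ 2)).
    by apply: eq_bigr => t _; ring.
  rewrite big_split sumrB /= sumr_const -!mulr_sumr.
  rewrite -!sum_support -/q -/s //; last by move=> t ->; rewrite expr0n.
  by rewrite -[s ^+ 2 *+ _]mulr_natl; ring.
by rewrite pmulr_rge0 // subr_ge0.
Qed.

Lemma sum_sqr_gt0 (F : realFieldType) (T : finType) (p : T -> F) :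
  \sum_t p t != 0 -> 0 < \sum_t p t ^+ 2.
Proof.
move=> s_neq0; have q_ge0 : 0 <= \sum_t p t ^+ 2.
  by apply: sumr_ge0 => t _; apply: sqr_ge0.
rewrite lt_def q_ge0 andbT; apply: contra_neq s_neq0 => q0.
have := sqr_sum_le_support p; rewrite q0 mulr0 => s2_le0.
by apply/eqP; rewrite -sqrf_eq0 eq_le s2_le0 sqr_ge0.
Qed.

Section Entropy.
Variable R : realType.

Let ln2_gt0 : 0 < ln (2 : R). Proof. by rewrite ln_gt0 // ltr1n. Qed.

Lemma ler_log2 : {in Num.pos &, {mono @log2 R : x y / x <= y}}.
Proof. by move=> x y x0 y0; rewrite /log2 ler_pM2r ?invr_gt0 // ler_ln. Qed.

Lemma log2V (x : R) : 0 < x -> log2 x^-1 = - log2 x.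
Proof. by move=> x0; rewrite /log2 lnV ?posrE // mulNr. Qed.

Lemma log2X k : log2 (2 ^+ k : R) = k%:R.
Proof. by rewrite /log2 lnXn ?ltr0n // -[ln 2 *+ k]mulr_natl mulfK // gt_eqF. Qed.

Lemma vn_entropyE n (M : 'M[R[i]]_n) (d : 'I_n -> R) :
  char_poly M = \prod_i ('X - ((d i)%:C%C)%:P) ->
  vn_entropy M = \sum_i negxlog2x (d i).
Proof.
move=> charM; rewrite /vn_entropy; pose s := [seq (d i)%:C%C | i <- index_enum 'I_n].
have charMs : char_poly M = \prod_(z <- s) ('X - z%:P) by rewrite big_map.
case: xgetP => [_ _ [s' [s'M ->]]|none].
  have /(perm_big _)-> : perm_eq s' s by apply: prod_XsubC_eq; rewrite -s'M.
  by rewrite big_map.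
by case: (none (\sum_i negxlog2x (d i))); exists s; split; rewrite // big_map.
Qed.

(* Jensen's inequality for [- ln], through its tangent at [q = \sum_t p t ^+ 2]:
   [- ln x >= 1 - x / q - ln q]. *)
Lemma collision_le_shannon (T : finType) (p : T -> R) :
  (forall t, 0 <= p t) -> \sum_t p t = 1 ->
  - log2 (\sum_t p t ^+ 2) <= \sum_t negxlog2x (p t).
Proof.
move=> p0 p1; set q := \sum_t p t ^+ 2.
have q0 : 0 < q by rewrite sum_sqr_gt0 // p1 oner_eq0.
have tangent t : p t * (1 - p t / q - ln q) / ln 2 <= negxlog2x (p t).
  rewrite /negxlog2x /log2; have [->|pt_neq0] := eqVneq (p t) 0.
    by rewrite !mul0r.
  have pt0 : 0 < p t by rewrite lt_def pt_neq0 p0.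
  have -> : - (p t * (ln (p t) / ln 2)) = p t * - ln (p t) / ln 2.
    by rewrite mulrN mulNr mulrA.
  rewrite ler_pM2r ?invr_gt0 // ler_pM2l //.
  have : ln (p t / q) <= p t / q - 1.
    have := @le_ln1Dx R (p t / q - 1); rewrite [1 + _]addrC subrK; apply.
    by rewrite ltrBrDr addNr divr_gt0.
  by rewrite ln_div //; lra.
apply: le_trans (ler_sum _ (fun t _ => tangent t)).
rewrite -mulr_suml /log2 -mulNr ler_pM2r ?invr_gt0 //.
have -> : \sum_t p t * (1 - p t / q - ln q) = (\sum_t p t) * (1 - ln q) - q / q.
  by rewrite !mulr_suml -sumrB; apply: eq_bigr => t _; ring.
by rewrite p1 divff ?gt_eqF //; lra.
Qed.

Lemma collision_le_log (T : finType) (p : T -> R) r :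
  \sum_t p t = 1 -> (#|[set t | (p t != 0)%R]| <= r)%N ->
  - log2 (\sum_t p t ^+ 2) <= log2 r%:R.
Proof.
move=> p1 supp_r; have := sqr_sum_le_support p; rewrite p1 expr1n => le_supp.
have q0 : 0 < \sum_t p t ^+ 2 by rewrite sum_sqr_gt0 // p1 oner_eq0.
have le_r : 1 <= r%:R * \sum_t p t ^+ 2.
  by apply: le_trans le_supp _; rewrite ler_pM2r // ler_nat.
have r0 : 0 < r%:R :> R by rewrite -(pmulr_lgt0 _ q0) (lt_le_trans ltr01).
by rewrite -log2V // ler_log2 ?posrE ?invr_gt0 // -div1r ler_pdivrMr.
Qed.

End Entropy.

(** * Purity under LOCC *)

Section Configurations.
Variable N : nat.
Implicit Types (x y z : cfg N) (A : {set 'I_N}).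

Definition supported A : pred (cfg N) :=
  fun x => [forall i, (i \notin A) ==> ~~ x i].

Lemma supportedP A x : reflect (forall i, i \notin A -> x i = false) (supported A x).
Proof.
apply: (iffP forallP) => supp i; last by apply/implyP => /supp->.
by move=> iA; have := supp i; rewrite iA => /negPf.
Qed.

Lemma glueC A x y : glue (~: A) x y = glue A y x.
Proof. by apply/ffunP => i; rewrite !ffunE inE; case: (i \in A). Qed.

Lemma glue_gluel A x y z : glue A (glue A x y) z = glue A x z.
Proof. by apply/ffunP => i; rewrite !ffunE; case: (i \in A). Qed.

Lemma glue_gluer A x y z : glue A x (glue A y z) = glue A x z.
Proof. by apply/ffunP => i; rewrite !ffunE; case: (i \in A). Qed.

Lemma glue_id A x : glue A x x = x.
Proof. by apply/ffunP => i; rewrite !ffunE if_same. Qed.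

Lemma sum_cfgOn (V : nmodType) A (F : cfg N -> V) :
  \sum_(a : cfgOn A) F (val a) = \sum_(x | supported A x) F x.
Proof. by rewrite -(big_sub (supported A)). Qed.

Lemma sum_glue (V : nmodType) A (F : cfg N -> V) :
  \sum_(a : cfgOn A) \sum_(z : cfgOn (~: A)) F (glue A (val a) (val z)) = \sum_x F x.
Proof.
rewrite (sum_cfgOn _ (fun x => \sum_(z : cfgOn (~: A)) F (glue A x (val z)))).
under eq_bigr => x _ do rewrite (sum_cfgOn _ (fun z => F (glue A x z))).
rewrite pair_big_dep /=; pose zero : cfg N := [ffun=> false].
rewrite (reindex_onto (fun x => (glue A x zero, glue A zero x))
                      (fun p => glue A p.1 p.2)) /=; last first.
  move=> [x z] /= /andP[/supportedP xA /supportedP zA]; congr pair.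
    by apply/ffunP => i; rewrite !ffunE; case iA: (i \in A); rewrite // xA ?iA.
  by apply/ffunP => i; rewrite !ffunE; case iA: (i \in A); rewrite // zA // inE iA.
apply: eq_big => x; rewrite glue_gluel glue_gluer glue_id // eqxx andbT.
by apply/andP; split; apply/supportedP => i; rewrite !ffunE ?inE ?negbK;
  [move/negPf-> | move->].
Qed.

Lemma setq_setq x k b c : setq (setq x k b) k c = setq x k c.
Proof. by apply/ffunP => i; rewrite !ffunE; case: eqP. Qed.

Lemma setq_id x k b : x k = b -> setq x k b = x.
Proof. by move=> <-; apply/ffunP => i; rewrite ffunE; case: eqP => [->|]. Qed.

Lemma sum_bit (V : nmodType) (P : pred (cfg N)) k (F : cfg N -> V) :
  (forall x b, P (setq x k b) = P x) ->
  \sum_(x | P x) F x = \sum_(x | P x && ~~ x k) \sum_(b : bool) F (setq x k b).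
Proof.
move=> P_setq; rewrite (bigID (fun x : cfg N => x k)) /=.
under [RHS]eq_bigr => x /andP[_ /negPf xk] do rewrite big_bool (setq_id xk).
rewrite [RHS]big_split; congr (_ + _).
rewrite (reindex_onto (fun x => setq x k true) (fun x => setq x k false)) /=.
  apply: eq_bigl => x; rewrite P_setq ffunE eqxx andbT setq_setq.
  congr (_ && _); apply/eqP/idP => [<-|/negPf/setq_id//].
  by rewrite ffunE eqxx.
by move=> x /andP[_ xk]; rewrite setq_setq setq_id.
Qed.

End Configurations.

Lemma dotmx_mxvec (C : numClosedFieldType) m n (M : 'M[C]_(m, n)) :
  dotmx (mxvec M) (mxvec M) = \tr (M *m M^t*).
Proof.
rewrite dotmxE mxE (reindex _ (curry_mxvec_bij _ _)) /=.
under [RHS]eq_bigr => i _ do rewrite mxE.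
rewrite [RHS]pair_bigA; apply: eq_bigr => -[i j] _ /=.
by rewrite mxvecE !mxE mxvecE.
Qed.

Section Purity.
Variable R : realType.
Local Notation C := (complex R).

Lemma kraus_sum m (ops : 'I_m -> qop R) (f g : bool -> C) : kraus_complete ops ->
  \sum_i \sum_b (\sum_c ops i b c * f c) * (\sum_c ops i b c * g c)^* =
  \sum_c f c * (g c)^*.
Proof.
move=> ops_complete.
transitivity (\sum_c \sum_c' (f c * (g c')^*) *
    \sum_(i < m) \sum_b (ops i b c')^* * ops i b c).
  under eq_bigr => i _.
    under eq_bigr => b _.
      rewrite rmorph_sum big_distrl /=.
      under eq_bigr => c _ do rewrite big_distrr /=.
      over.
    rewrite exchange_big /=.
    under eq_bigr => c _ do rewrite exchange_big /=.
    over.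
  rewrite exchange_big; apply: eq_bigr => c _.
  rewrite exchange_big; apply: eq_bigr => c' _ /=.
  rewrite mulr_sumr; apply: eq_bigr => i _; rewrite mulr_sumr.
  by apply: eq_bigr => b _; rewrite rmorphM; ring.
apply: eq_bigr => c _; rewrite (bigD1 c) //= ops_complete eqxx mulr1 big1 ?addr0 //.
by move=> c' /negPf cc'; rewrite ops_complete cc' mulr0.
Qed.

Variable N : nat.
Implicit Types (psi : qst R N) (A B : {set 'I_N}).

Definition amplitude_mx psi A : 'M[C]_(#|{: cfgOn A}|, #|{: cfgOn (~: A)}|) :=
  \matrix_(i, j) psi (glue A (val (enum_val i)) (val (enum_val j))).

Lemma rho_gram psi A : rho psi A = amplitude_mx psi A *m (amplitude_mx psi A)^t*.
Proof.
apply/matrixP => i j; rewrite !mxE big_enum_val; apply: eq_bigr => k _.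
by rewrite !mxE.
Qed.

Lemma rho_conj psi A : (rho psi A)^t* = rho psi A.
Proof. by rewrite rho_gram trmx_mul map_mxM trmxCK. Qed.

Lemma mxtrace_rho psi A : \tr (rho psi A) = (sqnorm psi)%:C%C.
Proof.
rewrite /sqnorm rmorph_sum -(sum_glue A) [RHS]big_enum_val /=.
apply: eq_bigr => i _; rewrite mxE; apply: eq_bigr => z _.
by rewrite -normCK normc_def -rmorphXn.
Qed.

Lemma rho_scale psi A c : rho [ffun x => c * psi x] A = (c * c^*) *: rho psi A.
Proof.
apply/matrixP => i j; rewrite !mxE mulr_sumr; apply: eq_bigr => z _.
by rewrite !ffunE rmorphM; ring.
Qed.

Lemma sqnorm_scale psi c :
  (sqnorm [ffun x => c * psi x])%:C%C = c * c^* * (sqnorm psi)%:C%C.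
Proof. by rewrite -!(mxtrace_rho _ set0) rho_scale mxtraceZ. Qed.

Lemma apply_local_glue B k (M : qop R) psi a x b : k \notin B ->
  apply_local k M psi (glue B a (setq x k b)) =
  \sum_c M b c * psi (glue B a (setq x k c)).
Proof.
move=> kB; rewrite ffunE !ffunE (negPf kB) eqxx; apply: eq_bigr => c _.
congr (_ * psi _); apply/ffunP => i; rewrite !ffunE.
by case: eqP => // ->; rewrite (negPf kB).
Qed.

Lemma rho_kraus B k m (ops : 'I_m -> qop R) psi : k \notin B ->
  kraus_complete ops -> \sum_i rho (apply_local k (ops i) psi) B = rho psi B.
Proof.
move=> kB ops_complete; apply/matrixP => s t; rewrite summxE.
pose term (phi : qst R N) x :=
  phi (glue B (val (enum_val s)) x) * (phi (glue B (val (enum_val t)) x))^*.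
have supp_setq x c : supported (~: B) (setq x k c) = supported (~: B) x.
  apply: eq_forallb => i; rewrite inE negbK ffunE.
  by case: eqP => // ->; rewrite (negPf kB).
have rhoE phi : rho phi B s t =
    \sum_(x | supported (~: B) x && ~~ x k) \sum_c term phi (setq x k c).
  by rewrite mxE (sum_cfgOn _ (term phi)) (sum_bit _ supp_setq).
under eq_bigr => i _ do rewrite rhoE.
rewrite rhoE exchange_big; apply: eq_bigr => x _ /=.
under eq_bigr => i _ do under eq_bigr => c _ do rewrite /term !apply_local_glue //.
exact: kraus_sum.
Qed.

Lemma sqnorm_kraus k m (ops : 'I_m -> qop R) psi : kraus_complete ops ->
  \sum_i (sqnorm (apply_local k (ops i) psi))%:C%C = (sqnorm psi)%:C%C :> C.
Proof.
move=> ops_complete; rewrite -(mxtrace_rho psi set0).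
rewrite -(rho_kraus psi _ ops_complete (k := k)) ?inE // raddf_sum.
by apply: eq_bigr => i _; rewrite /= mxtrace_rho.
Qed.

Definition purity psi A : C := \tr (rho psi A *m rho psi A).

Lemma purityE psi A : purity psi A = \sum_(x : cfg N) \sum_(y : cfg N)
  psi x * (psi (glue A y x))^* * (psi y * (psi (glue A x y))^*).
Proof.
rewrite -(sum_glue A) [RHS]big_enum_val; apply: eq_bigr => i _.
under [RHS]eq_bigr => z _ do rewrite -(sum_glue A) big_enum_val.
rewrite mxE [RHS]exchange_big; apply: eq_bigr => j _ /=.
rewrite !mxE mulr_suml; apply: eq_bigr => z _; rewrite mulr_sumr.
by apply: eq_bigr => w _; rewrite !glue_gluel !glue_gluer.
Qed.

Lemma purityC psi A : purity psi (~: A) = purity psi A.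
Proof.
by rewrite !purityE; do 2!apply: eq_bigr => ? _; rewrite !glueC; ring.
Qed.

Lemma dotmx_rho psi A : dotmx (mxvec (rho psi A)) (mxvec (rho psi A)) = purity psi A.
Proof. by rewrite dotmx_mxvec rho_conj. Qed.

Lemma purity_gt0 psi A : normalized psi -> 0 < purity psi A.
Proof.
move=> psi1; rewrite -dotmx_rho dnorm_gt0; apply/eqP => rho0.
have := mxtrace_rho psi A; rewrite psi1 -[rho psi A]mxvecK rho0 linear0 linear0.
by move/eqP; rewrite eq_sym oner_eq0.
Qed.

End Purity.

Section CollisionEntropy.
Variables (R : realType) (N : nat).
Implicit Types (psi : qst R N) (A : {set 'I_N}).

Definition rho_eigenvalue psi A (i : 'I_#|{: cfgOn A}|) : R :=
  complex.Re (spectral_diag (rho psi A) 0 i).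
Arguments rho_eigenvalue psi A i : clear implicits.

Let rho_normal psi A : rho psi A \is normalmx.
Proof. by rewrite rho_gram gram_normalmx. Qed.

Lemma rho_eigenvalue_ge0 psi A i : 0 <= rho_eigenvalue psi A i.
Proof.
have : 0 <= spectral_diag (rho psi A) 0 i by rewrite rho_gram spectral_diag_gram_ge0.
by rewrite lecE => /andP[].
Qed.

Lemma rho_eigenvalueE psi A i :
  spectral_diag (rho psi A) 0 i = (rho_eigenvalue psi A i)%:C%C.
Proof.
have : 0 <= spectral_diag (rho psi A) 0 i by rewrite rho_gram spectral_diag_gram_ge0.
rewrite lecE /rho_eigenvalue => /andP[/eqP /= im0 _].
by case: (spectral_diag _ 0 i) im0 => a b /= ->.
Qed.

Lemma sum_rho_eigenvalue psi A : \sum_i rho_eigenvalue psi A i = sqnorm psi.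
Proof.
apply: complexI; rewrite -(mxtrace_rho psi A) mxtrace_normal // rmorph_sum.
by apply: eq_bigr => i _; rewrite rho_eigenvalueE.
Qed.

Lemma purity_rho_eigenvalue psi A :
  complex.Re (purity psi A) = \sum_i rho_eigenvalue psi A i ^+ 2.
Proof.
rewrite /purity mxtrace_normal_sqr //.
under eq_bigr => i _ do rewrite rho_eigenvalueE -rmorphXn.
by rewrite -rmorph_sum.
Qed.

Definition collision_entropy psi A : R := - log2 (complex.Re (purity psi A)).

Lemma collision_entropy_le_vn psi A : normalized psi ->
  collision_entropy psi A <= vn_entropy (rho psi A).
Proof.
move=> psi1; rewrite /collision_entropy purity_rho_eigenvalue.
rewrite (vn_entropyE (d := rho_eigenvalue psi A)).
  apply: collision_le_shannon; first exact: rho_eigenvalue_ge0.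
  by rewrite sum_rho_eigenvalue.
by rewrite char_poly_normal //; apply: eq_bigr => i _; rewrite rho_eigenvalueE.
Qed.

Lemma collision_entropy_le_log_rank psi A : normalized psi ->
  collision_entropy psi A <= log2 (\rank (rho psi A))%:R.
Proof.
move=> psi1; rewrite /collision_entropy purity_rho_eigenvalue.
apply: collision_le_log; first by rewrite sum_rho_eigenvalue.
apply: leq_trans (mxrank_normal_ge (rho_normal psi A)).
apply/subset_leq_card/subsetP => i; rewrite !inE rho_eigenvalueE.
by rewrite (inj_eq (@complexI R)).
Qed.

End CollisionEntropy.

Lemma sqrtC_dotmx_sum (C : numClosedFieldType) n (I : finType) (v : I -> 'rV[C]_n) :
  sqrtC (dotmx (\sum_i v i) (\sum_i v i)) <= \sum_i sqrtC (dotmx (v i) (v i)).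
Proof.
apply: (big_ind2 (fun u r => sqrtC (dotmx u u) <= r)) => //.
  by rewrite dotmxE mul0mx mxE sqrtC0.
move=> u r w s ur ws; apply: le_trans (lerD ur ws).
exact: triangle_lerif.
Qed.

(* Measuring a qubit of one side decomposes the reduced state of the other side,
   so that the triangle inequality for the Frobenius norm applies. *)
Lemma achieves_purity_le (R : realType) N (P : protocol R N) (psi tgt : qst R N) A :
  achieves P psi tgt -> normalized tgt ->
  sqrtC (purity psi A) <= (sqnorm psi)%:C%C * sqrtC (purity tgt A).
Proof.
move=> + tgt1; elim: P psi A => [|k m ops next IH] psi A /=.
  case=> c ->; rewrite sqnorm_scale tgt1 mulr1 /purity rho_scale.
  rewrite -scalemxAl -scalemxAr scalerA mxtraceZ -expr2.
  have cc0 : 0 <= c * c^* by apply: mul_conjC_ge0.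
  by rewrite rootCMl ?exprn_ge0 // sqrCK.
case=> ops_complete achieves_next.
wlog kA : A / k \notin A.
  move=> wl; have [kA|] := boolP (k \in A); last exact: wl.
  by rewrite -(purityC psi) -(purityC tgt); apply: wl; rewrite inE kA.
rewrite -dotmx_rho -(rho_kraus psi kA ops_complete) raddf_sum.
apply: le_trans (sqrtC_dotmx_sum _) _.
rewrite -(sqnorm_kraus k psi ops_complete) mulr_suml; apply: ler_sum => i _.
by rewrite /= dotmx_rho; apply: IH.
Qed.

Section Embedding.
Variables (R : realType) (n N : nat) (f : 'I_n -> 'I_N).
Hypothesis f_inj : injective f.
Implicit Types (x y : cfg n) (phi : qst R n).
Local Notation targets := [set i in codom f].

Definition extend_cfg x : cfg N :=
  [ffun i => if [pick j | f j == i] is Some j then x j else false].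

Lemma extend_cfgE x j : extend_cfg x (f j) = x j.
Proof.
rewrite ffunE; case: pickP => [l /eqP/f_inj-> //|/(_ j)].
by rewrite eqxx.
Qed.

Lemma extend_cfg_supported x : supported targets (extend_cfg x).
Proof.
apply/supportedP => i; rewrite inE => i_out; rewrite ffunE.
by case: pickP => // j /eqP ji; rewrite -ji codom_f in i_out.
Qed.

Lemma supported_codom (z : cfg N) :
  supported targets z = [forall i, (i \notin codom f) ==> ~~ z i].
Proof. by apply: eq_forallb => i; rewrite inE. Qed.

Lemma embed_extend phi x : embed_state f phi (extend_cfg x) = phi x.
Proof.
rewrite ffunE -supported_codom extend_cfg_supported.
by congr (phi _); apply/ffunP => j; rewrite ffunE extend_cfgE.
Qed.

Lemma glue_extend A x y :
  glue A (extend_cfg x) (extend_cfg y) = extend_cfg (glue (f @^-1: A) x y).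
Proof.
apply/ffunP => i; have [/codomP[j ->]|i_out] := boolP (i \in codom f).
  by rewrite ffunE !extend_cfgE ffunE inE.
have out x' : extend_cfg x' i = false.
  by rewrite (supportedP _ _ (extend_cfg_supported x')) ?inE.
by rewrite ffunE !out if_same.
Qed.

Lemma sum_extend (V : nmodType) (F : cfg N -> V) :
  (forall z, ~~ supported targets z -> F z = 0) ->
  \sum_z F z = \sum_x F (extend_cfg x).
Proof.
move=> F0; rewrite (bigID (supported targets)) /= [X in _ + X]big1 // addr0.
rewrite (reindex_onto extend_cfg (fun z => [ffun j => z (f j)])) /=.
  apply: eq_bigl => x; rewrite extend_cfg_supported; apply/eqP/ffunP => j.
  by rewrite ffunE extend_cfgE.
move=> z /supportedP z_supp; apply/ffunP => i.
have [/codomP[j ->]|i_out] := boolP (i \in codom f); first by rewrite extend_cfgE ffunE.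
rewrite z_supp ?inE //.
by apply: (supportedP _ _ (extend_cfg_supported _)); rewrite inE.
Qed.

Lemma embed_unsupported phi z :
  ~~ supported targets z -> embed_state f phi z = 0.
Proof. by rewrite supported_codom ffunE => /negPf->. Qed.

Lemma sqnorm_embed phi : sqnorm (embed_state f phi) = sqnorm phi.
Proof.
rewrite /sqnorm sum_extend => [|z /embed_unsupported->]; last by rewrite mul0r.
by apply: eq_bigr => x _; rewrite embed_extend.
Qed.

Lemma purity_embed phi A : purity (embed_state f phi) A = purity phi (f @^-1: A).
Proof.
rewrite !purityE sum_extend => [|z /embed_unsupported z0]; last first.
  by rewrite big1 // => y _; rewrite z0 !mul0r.
apply: eq_bigr => x _; rewrite sum_extend => [|z /embed_unsupported->].
  by apply: eq_bigr => y _; rewrite !glue_extend !embed_extend.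
by rewrite mul0r mulr0.
Qed.

End Embedding.

Lemma locc_collision_entropy_ge (R : realType) N n (psi : qst R N) (phi : qst R n) :
  normalized psi -> normalized phi -> locc_ge psi phi ->
  exists2 f : 'I_n -> 'I_N, injective f &
    forall A : {set 'I_N},
      collision_entropy phi (f @^-1: A) <= collision_entropy psi A.
Proof.
move=> psi1 phi1 [_ [f [f_inj [P achieves_P]]]]; exists f => // A.
have tgt1 : normalized (embed_state f phi) by rewrite /normalized sqnorm_embed.
have := achieves_purity_le A achieves_P tgt1.
have psi_gt0 := purity_gt0 A psi1; have phi_gt0 := purity_gt0 (f @^-1: A) phi1.
rewrite psi1 mul1r purity_embed // ler_sqrtC ?nnegrE ?(ltW psi_gt0) ?(ltW phi_gt0) //.
move: psi_gt0 phi_gt0; rewrite !ltcE lecE /=.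
move=> /andP[_ psi_gt0] /andP[_ phi_gt0] /andP[_ purity_le].
by rewrite /collision_entropy lerN2 ler_log2.
Qed.

(** * Graph states *)

Lemma sum_glue_swap N (V : nmodType) (A : {set 'I_N}) (F : cfg N -> cfg N -> V) :
  \sum_x \sum_y F (glue A x y) (glue A y x) = \sum_x \sum_y F x y.
Proof.
rewrite !pair_big /=; pose swap (p : cfg N * cfg N) := (glue A p.1 p.2, glue A p.2 p.1).
have swapK : involutive swap.
  by case=> x y; rewrite /swap /= !glue_gluel !glue_gluer !glue_id.
by rewrite [RHS](reindex_inj (inv_inj swapK)).
Qed.

Lemma sum_ord_pairs (V : nmodType) n (g : 'I_n -> 'I_n -> V) :
  (forall u, g u u = 0) ->
  \sum_u \sum_v g u v = \sum_(u < n) \sum_(v < n | (u < v)%N) (g u v + g v u).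
Proof.
move=> g_diag; under [RHS]eq_bigr => u _ do rewrite big_split big_mkcond /=.
rewrite big_split /=.
under [X in _ + X]eq_bigr => u _ do rewrite big_mkcond /=.
rewrite [X in _ + X]exchange_big -big_split; apply: eq_bigr => u _ /=.
rewrite -big_split; apply: eq_bigr => v _ /=.
by case: ltngtP => [uv|uv|/val_inj->]; rewrite ?addr0 ?add0r.
Qed.

Definition row_cfg n (x : cfg n) : 'rV[bool]_n := \row_i x i.

Lemma row_cfg_bij n : bijective (@row_cfg n).
Proof.
exists (fun v : 'rV_n => [ffun i => v 0 i]) => [x|v].
  by apply/ffunP => i; rewrite ffunE mxE.
by apply/rowP => i; rewrite mxE ffunE.
Qed.

Lemma row_cfgD n (x y : cfg n) : row_cfg (x + y) = row_cfg x + row_cfg y.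
Proof. by apply/rowP => i; rewrite !mxE ffunE. Qed.

Lemma card_cfg_kernel m n (M : 'M[bool]_(n, m)) :
  #|[set x | row_cfg x *m M == 0]| = (2 ^ (n - \rank M))%N.
Proof.
rewrite -mxrank_ker -card_bool -card_rowg -(card_imset _ (bij_inj (row_cfg_bij n))).
apply: eq_card => v; rewrite mem_rowg; apply/imsetP/sub_kermxP => [[x xM ->]|vM].
  by apply/eqP; rewrite inE in xM.
have [cfg_of _ cfg_ofK] := row_cfg_bij n.
by exists (cfg_of v); rewrite ?inE cfg_ofK ?vM.
Qed.

Lemma signrD (C : pzRingType) (a b : bool) :
  (-1) ^+ (a + b : bool)%R = (-1) ^+ a * (-1) ^+ b :> C.
Proof. exact: signr_addb. Qed.

Lemma sum_sign_dot (C : comNzRingType) n (c : 'rV[bool]_n) :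
  \sum_(x : cfg n) (-1) ^+ (row_cfg x *m c^T) 0 0 = (2 ^+ n) *+ (c == 0) :> C.
Proof.
pose sign (b : bool) : C := (-1) ^+ b.
transitivity (\sum_(x : cfg n) \prod_i sign (x i && c 0 i)).
  apply: eq_bigr => x _; rewrite mxE.
  rewrite -/(sign _) (big_morph sign (op1 := *%R) (id1 := 1)) //; last exact: signrD.
  by apply: eq_bigr => i _; rewrite !mxE.
rewrite -(bigA_distr_bigA (fun i b => sign (b && c 0 i))) /=.
have [->|/rV0Pn[i ci]] := eqVneq c 0.
  rewrite mulr1n -[in RHS](card_ord n) -prodr_const; apply: eq_bigr => i _.
  by rewrite big_bool mxE.
have {}ci : c 0 i = true by case: (c 0 i) ci.
by rewrite (bigD1 i) //= big_bool /= ci /sign addNr mul0r.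
Qed.

Section GraphState.
Variables (R : realType) (n : nat) (E : rel 'I_n).
Hypothesis E_sym : symmetric E.
Local Notation C := (complex R).
Implicit Types (x y : cfg n) (A : {set 'I_n}).

Definition edge_parity x : bool :=
  \sum_(u < n) \sum_(v < n | (u < v)%N) (E u v && (x u && x v)).

Definition graph_state : qst R n :=
  [ffun x => sqrtC (2 ^+ n)^-1 * (-1) ^+ edge_parity x].

Definition cut_mx A : 'M[bool]_n :=
  \matrix_(u, v) [&& u \in A, v \notin A & E u v].

Definition cut_form A x y : bool := (row_cfg x *m (row_cfg y *m (cut_mx A)^T)^T) 0 0.

Lemma cut_formE A x y :
  cut_form A x y = \sum_u \sum_v (cut_mx A u v && (x u && y v)).
Proof.
rewrite /cut_form trmx_mul trmxK mulmxA mxE exchange_big; apply: eq_bigr => v _ /=.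
rewrite !mxE big_distrl; apply: eq_bigr => u _ /=.
by rewrite [row_cfg x 0 u]mxE; case: (x u); case: (cut_mx A u v); case: (y v).
Qed.

Lemma cut_formDl A x x' y : cut_form A (x + x') y = cut_form A x y + cut_form A x' y.
Proof. by rewrite /cut_form row_cfgD mulmxDl mxE. Qed.

Lemma cut_formDr A x y y' : cut_form A x (y + y') = cut_form A x y + cut_form A x y'.
Proof. by rewrite /cut_form row_cfgD mulmxDl linearD mulmxDr mxE. Qed.

Lemma cut_form_glue A x y x' y' :
  cut_form A (glue A x x') (glue A y' y) = cut_form A x y.
Proof.
rewrite !cut_formE; apply: eq_bigr => u _; apply: eq_bigr => v _.
by rewrite !mxE !ffunE; case: (u \in A) => //; case: (v \in A).
Qed.

Lemma edge_parity_glue A x y : edge_parity (glue A x y) =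
  edge_parity (glue A x 0) + edge_parity (glue A 0 y) + cut_form A x y.
Proof.
rewrite cut_formE sum_ord_pairs => [|u]; last by rewrite mxE; case: (u \in A).
rewrite -!big_split; apply: eq_bigr => u _ /=.
rewrite -!big_split; apply: eq_bigr => v _ /=.
rewrite !mxE !ffunE (E_sym v u).
by case: (u \in A); case: (v \in A); case: (E u v); case: (x u); case: (x v);
  case: (y u); case: (y v).
Qed.

Lemma edge_parity_polar A x y :
  edge_parity x + edge_parity (glue A y x) +
    (edge_parity y + edge_parity (glue A x y)) =
  cut_form A (x + y) (x + y).
Proof.
have := edge_parity_glue A x x; have := edge_parity_glue A y y.
rewrite !glue_id (edge_parity_glue A x y) (edge_parity_glue A y x) => -> ->.
rewrite cut_formDl !cut_formDr.
move: (edge_parity (glue A x 0)) (edge_parity (glue A 0 x)).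
move: (edge_parity (glue A y 0)) (edge_parity (glue A 0 y)).
move: (cut_form A x x) (cut_form A x y) (cut_form A y x) (cut_form A y y).
by do 8!case.
Qed.

Lemma graph_state_mul x y : graph_state x * (graph_state y)^* =
  (2 ^+ n)^-1 * ((-1) ^+ edge_parity x * (-1) ^+ edge_parity y).
Proof.
have amp_ge0 : 0 <= sqrtC (2 ^+ n : C)^-1 by rewrite sqrtC_ge0 invr_ge0 exprn_ge0.
rewrite !ffunE rmorphM /= (CrealP (ger0_real amp_ge0)).
rewrite [((-1) ^+ _)^*]rmorphXn rmorphN rmorph1.
by rewrite -[X in _ = X * _]sqrtCK; ring.
Qed.

Lemma normalized_graph_state : normalized graph_state.
Proof.
rewrite /normalized /sqnorm -raddf_sum /=.
under eq_bigr => x _ do rewrite graph_state_mul -expr2 sqrr_sign mulr1.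
rewrite sumr_const card_ffun card_bool card_ord -[_ *+ (2 ^ n)%N]mulr_natr natrX.
by rewrite mulVf // expf_neq0 // pnatr_eq0.
Qed.

Lemma sum_sign_cut_form A :
  \sum_(x : cfg n) \sum_(y : cfg n) (-1) ^+ cut_form A x y =
  2 ^+ n * 2 ^+ (n - \rank (cut_mx A)) :> C.
Proof.
rewrite exchange_big; under eq_bigr => y _ do rewrite sum_sign_dot.
rewrite sumrMnr -[LHS]mulr_natr; congr (_ * _).
by rewrite -big_mkcond /= sum1dep_card card_cfg_kernel mxrank_tr natrX.
Qed.

(* The phases depend only on [x + y], whose restrictions to the two sides of the cut
   can then be summed independently. *)
Lemma purity_graph_state A : purity graph_state A = (2 ^+ \rank (cut_mx A))^-1.
Proof.
have two_neq0 k : 2 ^+ k != 0 :> C by rewrite expf_neq0 // pnatr_eq0.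
rewrite purityE.
transitivity ((2 ^+ n)^-1 ^+ 2 *
    \sum_(x : cfg n) \sum_(d : cfg n) (-1) ^+ cut_form A d d : C).
  rewrite mulr_sumr; apply: eq_bigr => x _; rewrite mulr_sumr.
  rewrite [RHS](reindex_inj (addrI x)) /=; apply: eq_bigr => y _.
  by rewrite !graph_state_mul mulrACA -expr2 -!signrD edge_parity_polar.
rewrite -(sum_glue_swap A) exchange_big.
under eq_bigr => x _ do under eq_bigr => y _ do rewrite cut_form_glue.
rewrite sum_sign_cut_form.
have -> : 2 ^+ n = 2 ^+ (n - \rank (cut_mx A)) * 2 ^+ \rank (cut_mx A) :> C.
  by rewrite -exprD subnK // rank_leq_row.
by field; rewrite !two_neq0.
Qed.

Lemma collision_entropy_graph_state A :
  collision_entropy graph_state A = (\rank (cut_mx A))%:R.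
Proof.
rewrite /collision_entropy purity_graph_state.
have -> : (2 ^+ \rank (cut_mx A))^-1 = ((2 ^+ \rank (cut_mx A))^-1 : R)%:C%C.
  by rewrite fmorphV rmorphXn rmorph_nat.
by rewrite /= log2V ?exprn_gt0 // opprK log2X.
Qed.

Lemma mxrank_cut_matching A (I : {set 'I_n * 'I_n}) :
  cut_matching E A I -> (#|I| <= \rank (cut_mx A))%N.
Proof.
case=> I_cut I_induced; rewrite -[leqLHS](mxrank1 bool).
pose p (i : 'I_#|I|) := enum_val i.
suff <- : mxsub (fst \o p) (snd \o p) (cut_mx A) = 1%:M by apply: mxrank_mxsub.
apply/matrixP => i j; rewrite !mxE /= I_induced ?enum_valP // (inj_eq enum_val_inj).
have /andP[-> _] := I_cut _ (enum_valP i).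
by have /andP[_ ->] := I_cut _ (enum_valP j); case: (i == j).
Qed.

End GraphState.

(** * Widths of universal resources *)

Definition cluster_state (R : realType) m : qst R #|{: 'I_m * 'I_m}| :=
  graph_state R (fun i j => grid_rel (enum_val i) (enum_val j)).

Lemma normalized_cluster_state (R : realType) m : normalized (cluster_state R m).
Proof. exact: normalized_graph_state. Qed.

Lemma collision_entropy_cluster_ge (R : realType) m (A : {set 'I_#|{: 'I_m * 'I_m}|}) :
  (m * m <= 3 * #|A|)%N -> (m * m <= 3 * #|~: A|)%N ->
  m%:R <= 6 * collision_entropy (cluster_state R m) A.
Proof.
have card_pull (B : {set 'I_#|{: 'I_m * 'I_m}|}) : #|enum_rank @^-1: B| = #|B|.
  by apply: on_card_preimset; apply: onW_bij; apply: enum_rank_bij.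
rewrite -(card_pull A) -(card_pull (~: A)) preimsetC => A_large AC_large.
have [I I_match mI] := grid_balanced_matching A_large AC_large.
have [J J_match J_card] : exists2 J,
    cut_matching (fun i j => grid_rel (enum_val i) (enum_val j)) A J & #|J| = #|I|.
  apply: cut_matching_imset I_match => [|x y]; first exact: enum_rank_inj.
  by rewrite !enum_rankK.
have grid_sym : symmetric (fun i j : 'I_#|{: 'I_m * 'I_m}| =>
    grid_rel (enum_val i) (enum_val j)).
  move=> i j; rewrite /grid_rel /box_rel /path_rel.
  by congr (_ && _ || _ && _); rewrite 1?eq_sym 1?orbC.
rewrite collision_entropy_graph_state // -natrM ler_nat; apply: leq_trans mI _.
by rewrite leq_mul2l -J_card mxrank_cut_matching.
Qed.

Section Width.
Variables (R : realType) (N : nat).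
Implicit Types g h : {set 'I_N} -> R.

Lemma le_width g h : (forall A, g A <= h A) -> (width g <= width h)%E.
Proof.
move=> gh; rewrite /width; case: ifP => // _; apply/ereal_infP => _ [T ->].
apply: le_trans (_ : (tree_max T g)%:E <= _)%E.
  by apply: ereal_inf_lbound; exists T.
by rewrite lee_fin; apply: le_bigmax2.
Qed.

Lemma width_ge g (r : R) : (1 < N)%N ->
  (forall T : sctree N, exists u v : 'I_(nv T), tadj u v /\ r <= g (side u v)) ->
  (r%:E <= width g)%E.
Proof.
move=> N1 large_edge; rewrite /width leqNgt N1 /=.
apply/ereal_infP => _ [T ->]; rewrite lee_fin.
have [u [v [uv r_le]]] := large_edge T; apply: le_trans r_le _.
exact: (@le_bigmax_cond _ _ _ 0 (u, v) _ (fun e => g (side e.1 e.2))).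
Qed.

Lemma locc_cluster_width_ge m (psi : qst R N) :
  (1 < m)%N -> normalized psi -> locc_ge psi (cluster_state R m) ->
  ((m%:R / 6)%:E <= width (collision_entropy psi))%E.
Proof.
move=> m1 psi1 psi_locc; have [size_le _] := psi_locc.
have card_grid : #|{: 'I_m * 'I_m}| = (m * m)%N by rewrite card_prod card_ord.
have [f f_inj f_entropy] :=
  locc_collision_entropy_ge psi1 (normalized_cluster_state R m) psi_locc.
apply: width_ge => [|T]; first by apply: leq_trans size_le; rewrite card_grid; nia.
have [|u [v [uv A_large AC_large]]] := balanced_edge T f_inj.
  by rewrite card_grid; nia.
exists u, v; split=> //; apply: le_trans (f_entropy _); rewrite ler_pdivrMr // mulrC.
by apply: collision_entropy_cluster_ge; rewrite -card_grid.
Qed.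

End Width.

Section Resource.
Variables (R : realType) (E : forall N, qst R N -> \bar R) (Psi : set (mqstate R)).

Lemma sup_res_lt_pinfty (K : R) :
  (forall p, Psi p -> (E (projT2 p) <= K%:E)%E) -> (sup_res E Psi < +oo)%E.
Proof.
move=> E_le; apply: (@le_lt_trans _ _ K%:E); last exact: ltry.
by apply: ge_ereal_sup => _ [p Pp <-]; apply: E_le.
Qed.

Lemma universal_sup_res_pinfty :
  (forall N (psi : qst R N), normalized psi ->
     (width (collision_entropy psi) <= E psi)%E) ->
  (forall p, Psi p -> normalized (projT2 p)) -> universal Psi ->
  sup_res E Psi = +oo%E.
Proof.
move=> width_le Psi1 univ; apply/eqyP => K _.
pose m := (Num.truncn (6 * `|K|)).+2.
have Km : K <= m%:R / 6.
  rewrite ler_pdivlMr // mulrC; apply: le_trans (_ : 6 * `|K| <= _).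
    by rewrite ler_pM2l // ler_norm.
  by apply: ltW; apply: lt_le_trans (truncnS_gt _) _; rewrite ler_nat.
have [p [Pp p_locc]] := univ _ _ (normalized_cluster_state R m).
apply: (@le_trans _ _ (E (projT2 p))); last by apply: ereal_sup_ubound; exists p.
apply: le_trans (width_le _ _ (Psi1 p Pp)).
by apply: le_trans (locc_cluster_width_ge _ (Psi1 p Pp) p_locc).
Qed.

End Resource.

Theorem theorem5 (R : realType) (Psi : set (mqstate R)) :
  resource Psi ->
  (universal Psi ->
     sup_res (@E_wd R) Psi = +oo%E /\ sup_res (@chi_wd R) Psi = +oo%E) /\
  ((exists K : R, forall p, Psi p -> (E_wd (projT2 p) <= K%:E)%E) \/
   (exists K : R, forall p, Psi p -> (chi_wd (projT2 p) <= K%:E)%E) ->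
     ~ universal Psi).
Proof.
case=> _ Psi1.
have infinite_widths : universal Psi ->
    sup_res (@E_wd R) Psi = +oo%E /\ sup_res (@chi_wd R) Psi = +oo%E.
  move=> univ; split; apply: universal_sup_res_pinfty => // N psi psi1.
  - by apply: le_width => A; apply: collision_entropy_le_vn.
  - by apply: le_width => A; apply: collision_entropy_le_log_rank.
split=> // bounded /infinite_widths[E_wd_infty chi_wd_infty].
by case: bounded => -[K /sup_res_lt_pinfty];
  rewrite ?E_wd_infty ?chi_wd_infty ltxx.
Qed.
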